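(* For all integers $n,m\geqslant 0$, there is a bijection between the set of maximal chains in the poset $\Sigma_mC^n_m$ and the set of walks of length $(n+1)m$ in $C^n_m=\{0,\dots,m\}^n$ that start and end at $(0,\dots,0)$ and use only the steps $(1,1,\dots,1)$, $(-1,0,\dots,0)$, $(0,-1,\dots,0)$, $\dots$, $(0,0,\dots,-1)$.
   Context: $C_r$ is the chain $\{0<1<\dots<r\}$ and $C^n_r$ its $n$-th cartesian power with componentwise order. For fixed $n$, consider the sequence $C^n_0\to C^n_1\to\dots\to C^n_m$ where each map $C^n_r\to C^n_{r+1}$ is the coordinatewise inclusion (induced by including $C_r$ as the down-set $\{0,\dots,r\}$ of $C_{r+1}$). $\Sigma_mC^n_m$ is the stacking (lax sum) of this sequence: the poset of pairs $(x,j)$ with $0\leqslant j\leqslant m$, $x\in C^n_j$, ordered by $(x,j)\leqslant(y,l)$ iff $j\leqslant l$ and $x\leqslant y$ in $C^n_l$. A walk in $C^n_m$ is a sequence of points of $\{0,\dots,m\}^n$ in which consecutive points differ by one of the allowed steps. *)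

(* Defs.v *)
From HB Require Import structures.
From mathcomp Require Import all_boot all_order all_algebra.

Set Implicit Arguments.
Unset Strict Implicit.
Unset Printing Implicit Defensive.

Import Order.TTheory GRing.Theory.

(* [C_r] is ['I_r.+1]; [cube n r] carries the componentwise order. *)
Notation cube n r := (n.-tupleprod 'I_r.+1).

Definition cube_incl n r s (le_rs : r <= s) (x : cube n r) : cube n s :=
  [tuple widen_ord (le_rs : r.+1 <= s.+1) (tnth x i) | i < n].

(* The pair [(x, j)] is [Tagged _ x] with tag [j]. The alias is needed because
   sigma types already carry a lexicographic order in the library. *)
Definition stacking n m : Type := {j : 'I_m.+1 & cube n j}.

HB.instance Definition _ n m := Finite.on (stacking n m).

Section StackingOrder.
Variables n m : nat.
Implicit Types p q : stacking n m.

Definition stacking_le p q : bool :=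
  if @idP (tag p <= tag q) is ReflectT le_pq
  then (cube_incl le_pq (tagged p) <= tagged q)%O else false.

Lemma stacking_leE p q :
  stacking_le p q =
  (tag p <= tag q) &&
    [forall i, (tnth (tagged p) i : nat) <= tnth (tagged q) i].
Proof.
set rhs := [forall i, _].
have inclE (h : tag p <= tag q) :
    (cube_incl h (tagged p) <= tagged q)%O = rhs.
  by rewrite leEtprod; apply: eq_forallb => i; rewrite leEord tnth_mktuple.
have ifE (P : Prop) b (r : reflect P b) F X : (forall h : P, F h = X) ->
    (if r is ReflectT h then F h else false) = b && X.
  by case: r => // h ->.
exact: ifE.
Qed.

Lemma stacking_leP p q :
  reflect (exists le_pq : tag p <= tag q,
             (cube_incl le_pq (tagged p) <= tagged q)%O)
          (stacking_le p q).
Proof.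
have inclE (h : tag p <= tag q) :
    (cube_incl h (tagged p) <= tagged q)%O =
    [forall i, (tnth (tagged p) i : nat) <= tnth (tagged q) i].
  by rewrite leEtprod; apply: eq_forallb => i; rewrite leEord tnth_mktuple.
rewrite stacking_leE; apply: (iffP andP) => [[h le_xy]|[h]].
  by exists h; rewrite inclE.
by rewrite inclE.
Qed.

Fact stacking_le_refl : reflexive stacking_le.
Proof. by move=> p; rewrite stacking_leE leqnn; apply/forallP. Qed.

Fact stacking_le_anti : antisymmetric stacking_le.
Proof.
move=> [j x] [l y]; rewrite !stacking_leE /=.
case/andP=> /andP[jl /forallP xy] /andP[lj /forallP yx].
have ejl : j = l by apply/val_inj/eqP; rewrite eqn_leq jl.
case: _ / ejl y xy yx {jl lj} => y xy yx.
congr existT; apply: eq_from_tnth => i.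
by apply/val_inj/eqP; rewrite eqn_leq xy yx.
Qed.

Fact stacking_le_trans : transitive stacking_le.
Proof.
move=> q p r; rewrite !stacking_leE => /andP[pq /forallP xy] /andP[qr /forallP yz].
by rewrite (leq_trans pq qr); apply/forallP => i; apply: leq_trans (xy i) (yz i).
Qed.

End StackingOrder.

Fact stacking_display : Order.disp_t. Proof. exact: Order.Disp tt tt. Qed.

HB.instance Definition _ n m :=
  Order.Le_isPOrder.Build stacking_display (stacking n m)
    (@stacking_le_refl n m) (@stacking_le_anti n m) (@stacking_le_trans n m).

Definition is_chain d (P : finPOrderType d) (A : {set P}) : bool :=
  [forall x in A, forall y in A, (x >=< y)%O].

(* [maxset] means maximal for inclusion. *)
Definition is_max_chain d (P : finPOrderType d) (A : {set P}) : bool :=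
  maxset (@is_chain d P) A.

Definition origin n m : cube n m := [tuple ord0 | i < n].

Definition zvec n m (x : cube n m) : 'rV[int]_n :=
  (\row_i Posz (tnth x i))%R.

Definition is_step n (v : 'rV[int]_n) : bool :=
  (v == const_mx 1%R) || [exists i, v == (- delta_mx ord0 i)%R].

Definition step_rel n m : rel (cube n m) :=
  fun x y => is_step (zvec y - zvec x)%R.

(* A walk with [k] steps is the tuple of its [k.+1] successive points. *)
Definition is_loop_walk n m k (w : k.+1.-tuple (cube n m)) : bool :=
  [&& sorted (@step_rel n m) w,
      tnth w ord0 == origin n m & tnth w ord_max == origin n m].

(* Main.v *)
(* Send a point (x, j) of the stacking to the vector of gaps (j - x_1, ..., j - x_n).
   The stacking is graded by rank (x, j) = j + x_1 + ... + x_n, with rank (n+1)m at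
   the top, and its covers either increment j (all gaps grow by 1) or increment one
   x_i (the i-th gap drops by 1). Hence a maximal chain, listed by rank, becomes a
   closed walk. Conversely a walk remembers its chain, because
   (n+1) j = rank (x, j) + (sum of the gaps) recovers the level j from the time and
   the position. *)
Require Import Defs.
From mathcomp Require Import all_boot all_order all_algebra.
From mathcomp Require Import zify.

Set Implicit Arguments.
Unset Strict Implicit.
Unset Printing Implicit Defensive.

Import Order.TTheory.

(** * Maximal chains in a bounded graded finite poset *)

Section GradedMaxChain.
Variables (d : Order.disp_t) (P : finPOrderType d) (rk : P -> nat) (bot top : P).
Hypothesis rk_mono : forall p q, (p < q)%O -> rk p < rk q.
Hypothesis rk_interp : forall p q, (p < q)%O ->
  exists r, [/\ (p < r)%O, (r <= q)%O & rk r = (rk p).+1].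
Hypotheses (le_bot : forall p, (bot <= p)%O) (le_top : forall p, (p <= top)%O).

Lemma le_rk_eq p q : (p <= q)%O -> rk p = rk q -> p = q.
Proof.
rewrite le_eqVlt => /orP[/eqP //|/rk_mono]; lia.
Qed.

Lemma comparable_rk_le p q : (p >=< q)%O -> rk p <= rk q -> (p <= q)%O.
Proof.
case/orP=> // le_qp le_pq; move: le_qp; rewrite le_eqVlt => /orP[/eqP ->|] //.
by move/rk_mono; lia.
Qed.

Lemma chain_comparable (A : {set P}) p q :
  is_chain A -> p \in A -> q \in A -> (p >=< q)%O.
Proof. by move=> /forall_inP cA pA qA; have /forall_inP := cA p pA; apply. Qed.

Lemma chain_rk_inj (A : {set P}) p q :
  is_chain A -> p \in A -> q \in A -> rk p = rk q -> p = q.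
Proof.
move=> cA pA qA e; apply: le_rk_eq => //.
by apply: comparable_rk_le; rewrite ?e // (chain_comparable cA).
Qed.

Lemma max_chain_chain (A : {set P}) : is_max_chain A -> is_chain A.
Proof. by case/maxsetP. Qed.

(** Adjoining [p] to [A] still gives a chain, so maximality puts [p] in [A]. *)
Lemma max_chain_mem (A : {set P}) p :
  is_max_chain A -> (forall q, q \in A -> (p >=< q)%O) -> p \in A.
Proof.
case/maxsetP=> cA maxA cp; rewrite -(maxA (p |: A)) ?setU11 ?subsetUr //.
apply/forall_inP => x /setU1P xA; apply/forall_inP => y /setU1P yA.
case: xA yA => [->|xA] [->|yA]; first exact: comparablexx.
- exact: cp.
- by rewrite comparable_sym cp.
- exact: chain_comparable cA _ _.
Qed.

(** A maximal chain skips no rank: by induction on [k], a gap above an element of [A] could be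
    filled by an interpolated element comparable with all of [A]. *)
Lemma max_chain_rk (A : {set P}) k :
  is_max_chain A -> rk bot + k <= rk top ->
  exists2 p, p \in A & rk p = rk bot + k.
Proof.
move=> mA; have cA := max_chain_chain mA.
have topA : top \in A.
  by apply: max_chain_mem => // q _; rewrite comparable_sym le_comparable.
elim: k => [|k IHk] lek.
  exists bot; last by rewrite addn0.
  by apply: max_chain_mem => // q _; rewrite le_comparable.
have [|p pA rkp] := IHk; first lia.
(* [top] is in [A] and has rank beyond [rk p], so some [q] in [A] has least rank among those beyond
   [rk p]. *)
pose above := [pred q | (q \in A) && (rk p < rk q)].
have topP : above top by rewrite /= topA; lia.
case: (arg_minnP rk topP) => /= q /andP[qA lt_pq] minq.
have le_pq : (p < q)%O.
  rewrite lt_neqAle comparable_rk_le ?(ltnW lt_pq) ?(chain_comparable cA) // andbT.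
  by apply: contraTneq lt_pq => ->; rewrite ltnn.
have [r [lt_pr le_rq rkr]] := rk_interp le_pq.
exists r; last by rewrite rkr rkp addnS.
(* An element of [A] of rank at most [rk p] lies below [p]; any other has rank at least [rk q],
   hence lies above [q] and so above [r]. *)
apply: max_chain_mem => // s sA.
have [le_sp|lt_ps] := leqP (rk s) (rk p).
  have le_sp' := comparable_rk_le (chain_comparable cA sA pA) le_sp.
  by rewrite comparable_sym le_comparable // (le_trans le_sp') // ltW.
rewrite le_comparable // (le_trans le_rq) // comparable_rk_le //.
  exact: chain_comparable cA _ _.
by apply: minq; rewrite /= sA.
Qed.

(* A chain meeting every rank is maximal, as comparable elements of equal rank
   coincide. *)
Lemma full_chain_max (A : {set P}) :
  is_chain A -> (forall p, exists2 q, q \in A & rk q = rk p) -> is_max_chain A.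
Proof.
move=> cA fullA; apply/maxsetP; split=> // B cB /subsetP sAB.
apply/eqP; rewrite eqEsubset; apply/andP; split; apply/subsetP => //; move=> p pB.
have [q qA e] := fullA p.
by rewrite -(chain_rk_inj cB (sAB q qA) pB e).
Qed.

End GradedMaxChain.

(** * Levels, coordinates and gaps in the stacking *)

Section Stacking.
Variables n m : nat.
Local Notation N := ((n + 1) * m).
Implicit Types (p q r : stacking n m) (c d : cube n m).

Definition level p : nat := tag p.
Definition coord p (i : 'I_n) : nat := tnth (tagged p) i.
Definition rank p : nat := level p + \sum_i coord p i.

Definition gap p : cube n m := [tuple inord (level p - coord p i) | i < n].

Lemma level_le p : level p <= m.
Proof. by rewrite -ltnS ltn_ord. Qed.

Lemma coord_le p i : coord p i <= level p.
Proof. by rewrite -ltnS ltn_ord. Qed.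

Lemma stackP p q :
  reflect (level p <= level q /\ forall i, coord p i <= coord q i) (p <= q)%O.
Proof.
have -> : (p <= q)%O = stacking_le p q by [].
rewrite stacking_leE; apply: (iffP andP) => -[h1 h2]; split=> //; exact/forallP.
Qed.

Lemma stack_eq p q : level p = level q -> coord p =1 coord q -> p = q.
Proof.
by move=> el ec; apply/le_anti/andP; split; apply/stackP; split=> [|i];
   rewrite ?el ?ec.
Qed.

(** Builds points from plain natural numbers, so that later arguments never meet the dependent
    tag. *)
Lemma stack_ex j (x : 'I_n -> nat) :
  j <= m -> (forall i, x i <= j) -> exists2 p, level p = j & coord p =1 x.
Proof.
move=> lejm lexj.
pose y : cube n (inord j : 'I_m.+1) := [tuple inord (x i) | i < n].
exists (Tagged (fun j : 'I_m.+1 => cube n j) y); first exact: inordK.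
by move=> i; rewrite /coord /= tnth_mktuple inordK // inordK // ltnS.
Qed.

Lemma tnth_gap p i : tnth (gap p) i = level p - coord p i :> nat.
Proof.
by rewrite tnth_mktuple inordK // ltnS (leq_trans _ (level_le p)) // leq_subr.
Qed.

(** Each coordinate and its gap add up to the level, once for each of the [n] indices; the rank
    contributes one more level. *)
Lemma rank_gap p : rank p + \sum_i tnth (gap p) i = n.+1 * level p.
Proof.
rewrite /rank -addnA -big_split /=.
under eq_bigr => i _ do rewrite tnth_gap subnKC ?coord_le //.
by rewrite sum_nat_const card_ord mulSn.
Qed.

Lemma rank_gap_inj p q : rank p = rank q -> gap p = gap q -> p = q.
Proof.
move=> er eg; have el : level p = level q.
  by apply/eqP; rewrite -(eqn_pmul2l (ltn0Sn n)) -!rank_gap er eg.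
apply: stack_eq => // i; have := tnth_gap p i.
by rewrite eg tnth_gap el; have := coord_le p i; have := coord_le q i; lia.
Qed.

(** Restates integer steps over [nat]; a unit decrease is written as an addition on the side of [d]
    to avoid truncated subtraction. *)
Lemma step_relP c d :
  reflect ((forall i, tnth d i = (tnth c i).+1 :> nat) \/
           exists i, forall k, tnth c k = tnth d k + (k == i) :> nat)
          (step_rel c d).
Proof.
rewrite /step_rel /is_step; apply: (iffP orP).
  case=> [/eqP/rowP h|/existsP[i /eqP/rowP h]]; [left=> i | right; exists i => k].
    by have := h i; rewrite !mxE; lia.
  by have := h k; rewrite !mxE eqxx /=; case: (k == i) => /=; lia.
case=> [h|[i h]]; [left | right; apply/existsP; exists i].
  by apply/eqP/rowP => i; rewrite !mxE h; lia.
by apply/eqP/rowP => k; rewrite !mxE eqxx h; case: (k == i) => /=; lia.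
Qed.

(** * Covers of the stacking and their correspondence with steps *)

Definition upstep p q :=
  (level q = (level p).+1 /\ coord q =1 coord p) \/
  (level q = level p /\ exists i, forall k, coord q k = coord p k + (k == i)).

Lemma sum_pred1 (i : 'I_n) : \sum_k (k == i : nat) = 1.
Proof. by rewrite -(big_mkcond (pred1 i) (fun=> 1)) big_pred1_eq. Qed.

Lemma upstep_rank p q : upstep p q -> rank q = (rank p).+1.
Proof.
rewrite /rank; case=> -[-> h]; first by rewrite addSn (eq_bigr _ (fun i _ => h i)).
case: h => i h; rewrite (eq_bigr _ (fun k _ => h k)) big_split /= sum_pred1.
by rewrite addnA addn1.
Qed.

Lemma rank_leq p q : (p <= q)%O -> rank p <= rank q.
Proof. by case/stackP=> hl hc; apply: leq_add => //; apply: leq_sum. Qed.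

Lemma upstep_lt p q : upstep p q -> (p < q)%O.
Proof.
move=> u; rewrite lt_neqAle; apply/andP; split.
  by apply/eqP => e; have := upstep_rank u; rewrite e; lia.
by apply/stackP; case: u => -[-> h]; split=> [|i] //;
   [rewrite h | case: h => k ->; rewrite leq_addr].
Qed.

(** At equal levels some coordinate of [p] is strictly smaller and can be raised, staying within the
    level because [q] does. Otherwise the level is raised and the coordinates are kept. *)
Lemma upstep_interp p q : (p < q)%O -> exists2 r, upstep p r & (r <= q)%O.
Proof.
move=> lt_pq; have /stackP[hl hc] := ltW lt_pq.
move: hl; rewrite leq_eqVlt => /orP[/eqP hl|hl].
  have [i hi] : exists i, coord p i < coord q i.
    apply/existsP; apply: contraTT lt_pq => /existsPn h.
    have -> : p = q; last by rewrite ltxx.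
    by apply: stack_eq => // i; have := h i; have := hc i; lia.
  have hx k : coord p k + (k == i) <= coord q k.
    by case: eqVneq => [->|_] /=; rewrite ?addn1 ?addn0.
  have [|r lr cr] := stack_ex (level_le p) (x := fun k => coord p k + (k == i)).
    by move=> k; rewrite (leq_trans (hx k)) // hl coord_le.
  exists r; first by right; split=> //; exists i.
  by apply/stackP; split=> [|k]; rewrite ?lr ?hl // cr.
have [||r lr cr] := stack_ex (j := (level p).+1) (x := coord p).
- exact: leq_trans hl (level_le q).
- by move=> i; rewrite leqW ?coord_le.
- by exists r; [left | apply/stackP; split=> [|i]; rewrite ?lr ?cr].
Qed.

Lemma rank_ltn p q : (p < q)%O -> rank p < rank q.
Proof.
by move=> /upstep_interp[r /upstep_rank hr /rank_leq]; rewrite hr.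
Qed.

Lemma rank_interp p q : (p < q)%O ->
  exists r, [/\ (p < r)%O, (r <= q)%O & rank r = (rank p).+1].
Proof.
case/upstep_interp=> r u le_rq; exists r; split=> //; first exact: upstep_lt.
exact: upstep_rank.
Qed.

Lemma upstep_gap p q : upstep p q -> step_rel (gap p) (gap q).
Proof.
move=> u; apply/step_relP; case: u => -[hl].
  by move=> h; left=> i; rewrite !tnth_gap hl h; have := coord_le p i; lia.
case=> i h; right; exists i => k; rewrite !tnth_gap hl h.
by have := coord_le q k; rewrite hl h; lia.
Qed.

(** The up-step interpolated between [p] and [q] already has the rank of [q], hence equals [q]. *)
Lemma cover_gap p q :
  (p <= q)%O -> rank q = (rank p).+1 -> step_rel (gap p) (gap q).
Proof.
move=> le_pq e.
have /upstep_interp[r u le_rq] : (p < q)%O.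
  by rewrite lt_neqAle le_pq andbT; apply/eqP => epq; move: e; rewrite epq; lia.
by rewrite -(le_rk_eq rank_ltn le_rq) ?e ?(upstep_rank u) //; apply: upstep_gap.
Qed.

(** The bound serves the all-ones step: its left-hand side is then [n.+1] times the new level, which
    therefore is at most [m]. For a unit decrease, the gap being lowered is positive, so that
    coordinate has room to grow. *)
Lemma step_lift p d :
  step_rel (gap p) d -> (rank p).+1 + \sum_i tnth d i <= n.+1 * m ->
  exists2 q, upstep p q & gap q = d.
Proof.
move=> /step_relP hs hb; case: hs => [h|[i h]].
  have lt_pm : (level p).+1 <= m.
    rewrite -(leq_pmul2l (ltn0Sn n)) (leq_trans _ hb) // mulnS -rank_gap.
    under [X in _ <= _ + X]eq_bigr => i _ do rewrite h -addn1.
    by rewrite big_split /= sum_nat_const card_ord; lia.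
  have [|q lq cq] := stack_ex lt_pm (x := coord p).
    by move=> i; rewrite leqW ?coord_le.
  exists q; first by left.
  apply: eq_from_tnth => i; apply: val_inj => /=.
  by rewrite tnth_gap lq cq h tnth_gap; have := coord_le p i; lia.
have [|q lq cq] := stack_ex (level_le p) (x := fun k => coord p k + (k == i)).
  by move=> k; have := h k; rewrite tnth_gap; have := coord_le p k; lia.
exists q; first by right; split=> //; exists i.
apply: eq_from_tnth => k; apply: val_inj => /=.
by rewrite tnth_gap lq cq subnDA -tnth_gap h addnK.
Qed.

(** Hence time plus the sum of the gaps never decreases along a walk. *)
Lemma step_sum c d :
  step_rel c d -> \sum_i (tnth c i : nat) <= (\sum_i (tnth d i : nat)).+1.
Proof.
case/step_relP=> [h|[i h]].
  by apply: leqW; apply: leq_sum => i _; rewrite h.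
by rewrite (eq_bigr _ (fun k _ => h k)) big_split /= sum_pred1 addn1.
Qed.

(** * Extremal points, and the walk of a maximal chain *)

Lemma bot_ex : exists p, level p = 0 /\ coord p =1 fun=> 0.
Proof. by have [//|//|p lp cp] := @stack_ex 0 (fun=> 0); exists p. Qed.

Lemma top_ex : exists p, level p = m /\ coord p =1 fun=> m.
Proof. by have [//|//|p lp cp] := @stack_ex m (fun=> m); exists p. Qed.

Lemma bot_le p q : level p = 0 -> coord p =1 (fun=> 0) -> (p <= q)%O.
Proof. by move=> lp cp; apply/stackP; split=> [|i]; rewrite ?lp ?cp. Qed.

Lemma top_le p q : level q = m -> coord q =1 (fun=> m) -> (p <= q)%O.
Proof.
move=> lp cp; apply/stackP; split=> [|i]; rewrite ?lp ?cp ?level_le //.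
exact: leq_trans (coord_le p i) (level_le p).
Qed.

Lemma rank_bot p : level p = 0 -> coord p =1 (fun=> 0) -> rank p = 0.
Proof. by move=> lp cp; rewrite /rank lp big1 // => i _; rewrite cp. Qed.

Lemma rank_top p : level p = m -> coord p =1 (fun=> m) -> rank p = N.
Proof.
move=> lp cp; rewrite /rank lp (eq_bigr _ (fun i _ => cp i)).
by rewrite sum_nat_const card_ord; lia.
Qed.

Lemma rank_le p : rank p <= N.
Proof.
by have [t [lt ct]] := top_ex; rewrite -(rank_top lt ct); apply/rank_leq/top_le.
Qed.

Lemma gap_origin p : (forall i, coord p i = level p) -> gap p = origin n m.
Proof.
move=> h; apply: eq_from_tnth => i; apply: val_inj => /=.
by rewrite tnth_gap h subnn tnth_mktuple.
Qed.

Lemma sum_origin : \sum_i (tnth (origin n m) i : nat) = 0.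
Proof. by apply: big1 => i _; rewrite tnth_mktuple. Qed.

(** The default [origin] is never reached when [A] is a maximal chain, since [A] then has exactly
    one element of each rank. *)
Definition walk_of (A : {set stacking n m}) : N.+1.-tuple (cube n m) :=
  [tuple oapp gap (origin n m) [pick p in A | rank p == k] | k < N.+1].

(** The points whose gaps match the walk at the time given by their rank; [inord] is harmless since
    ranks are at most [N]. *)
Definition chain_of (w : N.+1.-tuple (cube n m)) : {set stacking n m} :=
  [set p | gap p == tnth w (inord (rank p))].

Lemma chain_ofP (w : N.+1.-tuple (cube n m)) p :
  reflect (gap p = nth (origin n m) w (rank p)) (p \in chain_of w).
Proof.
rewrite inE (tnth_nth (origin n m)) inordK ?ltnS ?rank_le //; exact: eqP.
Qed.

Lemma nth_walk_of (A : {set stacking n m}) p :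
  is_chain A -> p \in A -> nth (origin n m) (walk_of A) (rank p) = gap p.
Proof.
move=> cA pA; have lt_p : rank p < N.+1 by rewrite ltnS rank_le.
rewrite -[rank p]/(val (Ordinal lt_p)) -tnth_nth tnth_mktuple.
case: pickP => [q /andP[qA /eqP e]|/(_ p)]; last by rewrite pA eqxx.
by rewrite (chain_rk_inj rank_ltn cA qA pA).
Qed.

Lemma max_chain_rank (A : {set stacking n m}) k :
  is_max_chain A -> k <= N -> exists2 p, p \in A & rank p = k.
Proof.
move=> mA lek; have [b [lb cb]] := bot_ex; have [t [lt ct]] := top_ex.
have [|p pA rp] := max_chain_rk rank_ltn rank_interp
    (fun q => bot_le q lb cb) (fun q => top_le q lt ct) mA (k := k).
  by rewrite (rank_bot lb cb) (rank_top lt ct).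
by exists p => //; rewrite rp (rank_bot lb cb).
Qed.

Lemma walk_of_loop (A : {set stacking n m}) :
  is_max_chain A -> is_loop_walk (walk_of A).
Proof.
move=> mA; have cA := max_chain_chain mA.
have [b [lb cb]] := bot_ex; have [t [lt ct]] := top_ex.
apply/and3P; split.
- apply/(sortedP (origin n m)) => k; rewrite size_tuple ltnS => lek.
  have [p pA rp] := max_chain_rank mA (ltnW lek).
  have [q qA rq] := max_chain_rank mA lek.
  rewrite -rq nth_walk_of // -rp nth_walk_of // cover_gap ?rq ?rp //.
  by rewrite (comparable_rk_le rank_ltn (chain_comparable cA pA qA)) ?rp ?rq.
(* The element of rank 0 is the bottom, and the one of rank [N] below is the top; both have zero
   gaps. *)
- have [p pA rp] := max_chain_rank mA (leq0n N).
  rewrite (tnth_nth (origin n m)) [X in nth _ _ X](_ : _ = rank p) ?nth_walk_of //.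
  rewrite -(le_rk_eq rank_ltn (bot_le p lb cb)) ?(rank_bot lb cb) //.
  by apply/eqP/gap_origin => i; rewrite lb cb.
- have [p pA rp] := max_chain_rank mA (leqnn N).
  rewrite (tnth_nth (origin n m)) [X in nth _ _ X](_ : _ = rank p) ?nth_walk_of //.
  rewrite (le_rk_eq rank_ltn (top_le p lt ct)) ?(rank_top lt ct) //.
  by apply/eqP/gap_origin => i; rewrite lt ct.
Qed.

(** * The maximal chain of a closed walk *)

Section WalkChain.
Variable w : N.+1.-tuple (cube n m).
Hypothesis loop_w : is_loop_walk w.
Local Notation w_ k := (nth (origin n m) w k).

Lemma walk_step k : k < N -> step_rel (w_ k) (w_ k.+1).
Proof.
move=> ltk; have /and3P[/(sortedP (origin n m)) h _ _] := loop_w.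
by apply: h; rewrite size_tuple ltnS.
Qed.

(* By [rank_gap] the left-hand side is [n.+1] times the level reached at time [k];
   levels never decrease along a walk and the last one is [m]. *)
Lemma walk_level_bound k : k <= N -> k + \sum_i tnth (w_ k) i <= n.+1 * m.
Proof.
move=> lek; rewrite -(subKn lek); elim: (N - k) (leq_subr k N) => [|t IHt] let_.
  have /and3P[_ _] := loop_w; rewrite (tnth_nth (origin n m)) /= => /eqP h.
  by rewrite subn0 h sum_origin addn0 addn1.
have ltt : N - t.+1 < N by lia.
have := step_sum (walk_step ltt).
have -> : (N - t.+1).+1 = N - t by lia.
by have := IHt (ltnW let_); lia.
Qed.

Lemma chain_of_next p : p \in chain_of w -> rank p < N ->
  exists2 q, upstep p q & q \in chain_of w.
Proof.
move=> /chain_ofP gp ltp.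
have [||q u gq] := @step_lift p (w_ (rank p).+1).
- by rewrite gp walk_step.
- exact: walk_level_bound.
by exists q => //; apply/chain_ofP; rewrite (upstep_rank u).
Qed.

Lemma chain_of_above p t : p \in chain_of w -> rank p + t <= N ->
  exists q, [/\ q \in chain_of w, (p <= q)%O & rank q = rank p + t].
Proof.
move=> pw; elim: t => [|t IHt] let_; first by exists p; rewrite addn0.
have [|q [qw le_pq rq]] := IHt; first lia.
have [|r u rw] := chain_of_next qw; first lia.
exists r; split=> //; last by rewrite (upstep_rank u) rq addnS.
exact: le_trans le_pq (ltW (upstep_lt u)).
Qed.

(** The walk starts at the origin, so the bottom belongs to [chain_of w], and one climbs from
    there. *)
Lemma chain_of_rank k : k <= N -> exists2 p, p \in chain_of w & rank p = k.
Proof.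
move=> lek; have [b [lb cb]] := bot_ex; have rb := rank_bot lb cb.
have bw : b \in chain_of w.
  apply/chain_ofP; rewrite rb gap_origin; last by move=> i; rewrite lb cb.
  by have /and3P[_ /eqP h _] := loop_w; rewrite -[LHS]h (tnth_nth (origin n m)).
have [|p [pw _ rp]] := chain_of_above (t := k) bw; first by rewrite rb.
by exists p => //; rewrite rp rb.
Qed.

(** Climbing from [p] inside [chain_of w] to the rank of [q] reaches a point with the same rank and
    gaps as [q], which is [q] by [rank_gap_inj]. *)
Lemma chain_of_le p q :
  p \in chain_of w -> q \in chain_of w -> rank p <= rank q -> (p <= q)%O.
Proof.
move=> pw qw le_pq.
have [|r [rw le_pr rr]] := chain_of_above (t := rank q - rank p) pw.
  by rewrite subnKC ?rank_le.
rewrite subnKC // in rr; rewrite -(rank_gap_inj rr) //.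
by rewrite (chain_ofP _ _ rw) (chain_ofP _ _ qw) rr.
Qed.

Lemma chain_of_chain : is_chain (chain_of w).
Proof.
apply/forall_inP => p pw; apply/forall_inP => q qw; apply/orP.
have [h|h] := leqP (rank p) (rank q); [left | right].
  exact: chain_of_le.
exact: chain_of_le (ltnW h).
Qed.

Lemma chain_of_max : is_max_chain (chain_of w).
Proof.
apply: (full_chain_max rank_ltn chain_of_chain) => p.
exact: chain_of_rank (rank_le p).
Qed.

Lemma chain_ofK : walk_of (chain_of w) = w.
Proof.
apply: eq_from_tnth => k; rewrite !(tnth_nth (origin n m)).
have [|p pw <-] := @chain_of_rank k; first by rewrite -ltnS ltn_ord.
by rewrite nth_walk_of ?chain_of_chain //; apply/chain_ofP.
Qed.

End WalkChain.

Lemma walk_ofK (A : {set stacking n m}) :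
  is_max_chain A -> chain_of (walk_of A) = A.
Proof.
move=> mA; have cA := max_chain_chain mA.
apply/setP => p; apply/chain_ofP/idP => [gp|pA]; last by rewrite nth_walk_of.
(* The element [q] of [A] at the rank of [p] has the gaps prescribed by the walk, as [p] does, so
   the two coincide. *)
have [q qA rq] := max_chain_rank mA (rank_le p).
by rewrite (@rank_gap_inj p q) // gp -rq nth_walk_of.
Qed.

End Stacking.

Theorem theorem5p2 (n m : nat) :
  exists f : {A : {set stacking n m} | is_max_chain A} ->
             {w : ((n + 1) * m).+1.-tuple (cube n m) | is_loop_walk w},
    bijective f.
Proof.
exists (fun A => exist _ (walk_of (val A)) (walk_of_loop (valP A))).
exists (fun w => exist _ (chain_of (val w)) (chain_of_max (valP w))) => x.
  exact/val_inj/(walk_ofK (valP x)).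
exact/val_inj/(chain_ofK (valP x)).
Qed.
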